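(* Let $A$ be an $n\times n$ (real symmetric) positive definite matrix and let the integer $p$ satisfy $1<p<n$. Let $S\in\mathbb{R}^{n\times p}$ be the random column selector matrix corresponding to uniformly selecting $p$ coordinates from $\{1,\dots,n\}$ without replacement, let $H=S(S^{T}AS)^{\dagger}S^{T}$, $G=\mathbb{E}[H]$, and $\nu=\lambda_{\max}\left(\mathbb{E}\left[(G^{-1/2}HG^{-1/2})^2\right]\right)$. Then $$\frac np\leq\nu\leq\frac np\left(\frac{p-1}{n-1}+\left(1-\frac{p-1}{n-1}\right)\kappa_{\mathrm{eff},p}(A)\right),$$ where $\kappa_{\mathrm{eff},p}(A)=\max_{J\subseteq\{1,\dots,n\}:|J|=p}\kappa_{\mathrm{eff},J}(A)$.
   Context: For an index set $J\subseteq\{1,\dots,n\}$, $A_J$ denotes the principal sub-matrix of $A$ indexed by $J$, and the effective block condition number is $\kappa_{\mathrm{eff},J}(A)=\frac{\max_{i\in J}A_{ii}}{\lambda_{\min}(A_J)}$. The column selector matrix of $J=\{J(1),\dots,J(p)\}$ is $(e_{J(1)},\dots,e_{J(p)})\in\mathbb{R}^{n\times p}$, with $e_i$ the standard basis vectors of $\mathbb{R}^n$. $M^{\dagger}$ is the Moore-Penrose pseudo-inverse, $M^{1/2}$ the positive semi-definite square root, and $\lambda_{\min},\lambda_{\max}$ the smallest and largest eigenvalues. ($G$ is positive definite for this sampling distribution.) *)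

(* Defs.v *)
From HB Require Import structures.
From mathcomp Require Import all_boot all_order all_algebra.
From mathcomp Require Import all_classical all_reals.

Set Implicit Arguments.
Unset Strict Implicit.
Unset Printing Implicit Defensive.

Import Order.TTheory GRing.Theory Num.Theory.
Local Open Scope classical_set_scope.
Local Open Scope ring_scope.

Definition posdefmx (R : realType) (n : nat) (M : 'M[R]_n) : Prop :=
  M^T = M /\ forall x : 'cV[R]_n, x != 0 -> 0 < (x^T *m M *m x) 0 0.

Definition possemidefmx (R : realType) (n : nat) (M : 'M[R]_n) : Prop :=
  M^T = M /\ forall x : 'cV[R]_n, 0 <= (x^T *m M *m x) 0 0.

(* A matrix has finitely many eigenvalues, so when it has at least one the
   supremum and infimum below are a maximum and a minimum. *)
Definition lambda_max (R : realType) (n : nat) (M : 'M[R]_n) : R :=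
  sup [set a : R | eigenvalue M a].

Definition lambda_min (R : realType) (n : nat) (M : 'M[R]_n) : R :=
  inf [set a : R | eigenvalue M a].

(* The four Penrose conditions; every real matrix has exactly one such X.
   MathComp's [pinvmx] is only a partial inverse satisfying the first one. *)
Definition is_moore_penrose (R : realType) (m n : nat)
    (M : 'M[R]_(m, n)) (X : 'M[R]_(n, m)) : Prop :=
  [/\ M *m X *m M = M, X *m M *m X = X,
      (M *m X)^T = M *m X & (X *m M)^T = X *m M].

Definition moore_penrose (R : realType) (m n : nat) (M : 'M[R]_(m, n)) :
    'M[R]_(n, m) :=
  xget 0 [set X | is_moore_penrose M X].

(* Every positive semi-definite M has exactly one such square root. *)
Definition sqrtmx (R : realType) (n : nat) (M : 'M[R]_n) : 'M[R]_n :=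
  xget 0 [set X : 'M[R]_n | possemidefmx X /\ X *m X = M].

(* [enum_val] lists J in increasing order: it plays the role of J(1), ..., J(p),
   with p = #|J|. *)
Definition principal_submx (R : realType) (n : nat) (J : {set 'I_n})
    (M : 'M[R]_n) : 'M[R]_#|J| :=
  \matrix_(k, l) M (enum_val k) (enum_val l).

Definition selector_mx (R : realType) (n : nat) (J : {set 'I_n}) :
    'M[R]_(n, #|J|) :=
  \matrix_(i, k) (i == enum_val k)%:R.

Definition kappa_eff (R : realType) (n : nat) (J : {set 'I_n}) (M : 'M[R]_n) : R :=
  sup [set a : R | exists2 i, i \in J & a = M i i]
    / lambda_min (principal_submx J M).

Definition kappa_eff_size (R : realType) (n p : nat) (M : 'M[R]_n) : R :=
  sup [set k : R | exists2 J : {set 'I_n}, #|J| = p & k = kappa_eff J M].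

(* Expectation of F J for J uniform among the subsets of size p. *)
Definition subset_mean (R : realType) (n p : nat)
    (F : {set 'I_n} -> 'M[R]_n) : 'M[R]_n :=
  #|[pred J : {set 'I_n} | #|J| == p]|%:R^-1
    *: \sum_(J : {set 'I_n} | #|J| == p) F J.

(* Main.v *)
Require Import Defs.
From HB Require Import structures.
From mathcomp Require Import all_boot all_order all_algebra.
From mathcomp Require Import all_classical all_reals.
From mathcomp Require Import sesquilinear spectral complex ring lra zify.

(** Write H for the random padded block inverse, D for the projection onto the
    selected coordinates, G = E[H], K = G^(-1/2) and X = K H K.  Then
    E[X] = K G K is the identity and each X is symmetric of rank p.

    Lower bound.  The largest eigenvalue of E[X^2] is at least its trace over
    n.  A symmetric matrix of rank p satisfies
    tr(X^2) >= 2 c tr X - c^2 p for every c ([trace_sq_ge]); averaging with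
    c = n/p and E[tr X] = n gives E[tr X^2] >= n^2/p.

    Upper bound.  With z = H K u the form of X^2 at u is z^T G^-1 z, while the
    form of X at u is z^T A z because H A H = H, and the latter averages to
    |u|^2.  So it is enough to bound G^-1 by a multiple of A on vectors
    supported on the selected coordinates.  For all x and w,
    x^T H x >= 2 x^T D w - w^T D A D w ([subinv_form_ge]); since this can be
    averaged, and E[D] = (p/n) I, the choice x = G^-1 v, w = (n/p) v yields
    v^T G^-1 v <= (n/p)^2 v^T E[D A D] v ([invmx_mean_subinv_form_le]).
    Counting subsets, E[D A D] = (p/n) (r A + (1 - r) diag A) with
    r = (p-1)/(n-1) ([mean_selproj_conj]), and on vectors supported on J the
    diagonal of A is at most the effective condition number of the block times
    A ([diag_form_le_kappa]).

    The orthogonal diagonalization of real symmetric matrices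
    ([symmetric_diagonalizable]) underlies the square root of G, the trace
    bound and the Rayleigh bound for the smallest eigenvalue. *)

Set Implicit Arguments.
Unset Strict Implicit.
Unset Printing Implicit Defensive.

Import Order.TTheory GRing.Theory Num.Theory.
Local Open Scope ring_scope.

(** * Bilinear forms of matrices *)

(** The estimates below compare matrices through these scalars instead of
    through a partial order on symmetric matrices. *)
Definition bform (R : pzRingType) (n : nat) (M : 'M[R]_n) (x y : 'cV[R]_n) : R :=
  (x^T *m M *m y) 0 0.

Lemma bformBl (R : pzRingType) (n : nat) (M : 'M[R]_n) (x y z : 'cV[R]_n) :
  bform M (x - y) z = bform M x z - bform M y z.
Proof. by rewrite /bform raddfB /= !mulmxBl !mxE. Qed.

Lemma bformBr (R : pzRingType) (n : nat) (M : 'M[R]_n) (x y z : 'cV[R]_n) :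
  bform M x (y - z) = bform M x y - bform M x z.
Proof. by rewrite /bform mulmxBr !mxE. Qed.

Lemma bformZl (R : comPzRingType) (n : nat) (M : 'M[R]_n) (a : R) (x y : 'cV[R]_n) :
  bform M (a *: x) y = a * bform M x y.
Proof. by rewrite /bform linearZ /= -!scalemxAl mxE. Qed.

Lemma bformZr (R : comPzRingType) (n : nat) (M : 'M[R]_n) (a : R) (x y : 'cV[R]_n) :
  bform M x (a *: y) = a * bform M x y.
Proof. by rewrite /bform -scalemxAr mxE. Qed.

Lemma bform_tr (R : comPzRingType) (n : nat) (M : 'M[R]_n) (x y : 'cV[R]_n) :
  bform M^T x y = bform M y x.
Proof.
rewrite /bform -(trmxK (x^T *m M^T *m y)) [LHS]mxE.
by rewrite !trmx_mul !trmxK mulmxA.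
Qed.

Lemma bform_sym (R : comPzRingType) (n : nat) (M : 'M[R]_n) (x y : 'cV[R]_n) :
  M^T = M -> bform M x y = bform M y x.
Proof. by move=> Ms; rewrite -{1}Ms bform_tr. Qed.

Lemma bform_mull (R : comPzRingType) (m n : nat) (L : 'M[R]_(n, m)) (M : 'M[R]_n)
    (x : 'cV[R]_m) (y : 'cV[R]_m) :
  bform M (L *m x) (L *m y) = bform (L^T *m M *m L) x y.
Proof. by rewrite /bform trmx_mul !mulmxA. Qed.

Lemma bform_diag (R : comPzRingType) (n : nat) (d : 'rV[R]_n) (x : 'cV[R]_n) :
  bform (diag_mx d) x x = \sum_i d 0 i * x i 0 ^+ 2.
Proof.
rewrite /bform mul_mx_diag mxE; apply: eq_bigr => i _.
by rewrite !mxE expr2 mulrAC mulrC.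
Qed.

Lemma sqnormE (R : comPzRingType) (n : nat) (x : 'cV[R]_n) :
  bform 1%:M x x = \sum_i x i 0 ^+ 2.
Proof.
by rewrite -diag_const_mx bform_diag; apply: eq_bigr => i _; rewrite mxE mul1r.
Qed.

Lemma sqnorm_ge0 (R : realDomainType) (n : nat) (x : 'cV[R]_n) :
  0 <= bform 1%:M x x.
Proof. by rewrite sqnormE sumr_ge0 // => i _; rewrite sqr_ge0. Qed.

Lemma sqnorm_eq0 (R : realDomainType) (n : nat) (x : 'cV[R]_n) :
  (bform 1%:M x x == 0) = (x == 0).
Proof.
rewrite sqnormE psumr_eq0 => [|i _]; last exact: sqr_ge0.
apply/allP/eqP => [x0|-> i _]; last by rewrite mxE expr0n /= eqxx.
apply/colP => i; rewrite mxE; apply/eqP.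
by have := x0 i (mem_index_enum i); rewrite /= sqrf_eq0.
Qed.

Lemma sqnorm_gt0 (R : realDomainType) (n : nat) (x : 'cV[R]_n) :
  (0 < bform 1%:M x x) = (x != 0).
Proof. by rewrite lt_def sqnorm_eq0 sqnorm_ge0 andbT. Qed.

(** * Orthogonal diagonalization of real symmetric matrices *)

(** Stated over any field because it serves twice: over R[i], to read a real
    eigenvalue off the complex diagonalization, and over R. *)
Lemma eigenvalue_diagonalized (F : fieldType) (n : nat) (M P : 'M[F]_n)
    (d : 'rV[F]_n) (a : F) :
  P \in unitmx -> M = invmx P *m diag_mx d *m P ->
  eigenvalue M a <-> exists i, a = d 0 i.
Proof.
move=> Pu ->; split.
  case/eigenvalueP => v; rewrite -[v](mulmxKV Pu).
  set y := v *m invmx P => vM v0.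
  have /rV0Pn[i yi0] : y != 0 by apply: contraNneq v0 => ->; rewrite mul0mx.
  exists i; apply: (mulIf yi0).
  have: y *m diag_mx d = a *: y.
    apply: (can_inj (mulmxK Pu)).
    by rewrite -scalemxAl -vM !mulmxA (mulmxK Pu).
  by move/matrixP/(_ 0 i); rewrite mul_mx_diag !mxE => <-; rewrite mulrC.
case=> i ->; apply/eigenvalueP; exists (row i P).
  by rewrite rowE -!mulmxA (mulKVmx Pu) mulmxA -rowE row_diag_mx -scalemxAl.
apply: contraTneq Pu => Pi0; apply/negP => Pu.
have := row_mul i P (invmx P); rewrite mulmxV // Pi0 mul0mx row1.
by move/matrixP/(_ 0 i)/eqP; rewrite !mxE !eqxx oner_eq0.
Qed.

(** Seen over R[i] the matrix is Hermitian, so it is unitarily diagonalizable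
    with real diagonal; a real eigenvalue over R[i] is already one over R. *)
Lemma symmetric_eigenvalue_exists (R : rcfType) (n : nat) (M : 'M[R]_n.+1) :
  M^T = M -> exists a, eigenvalue M a.
Proof.
move=> Ms; pose Mc := map_mx (real_complex R) M.
have Mherm : Mc \is hermsymmx.
  apply: realsym_hermsym.
    by apply/is_hermitianmxP; rewrite scale1r map_mx_id // map_trmx Ms.
  by apply/mxOverP => i j; rewrite mxE; apply/complex_realP; exists (M i j).
have [k dk] : exists k, spectral_diag Mc 0 0 = k%:C%C.
  by apply/complex_realP; exact: (mxOverP (hermitian_spectral_diag_real Mherm)).
exists k; rewrite -(eigenvalue_map (real_complex R)).
have Mspec := orthomx_spectralP (hermitian_normalmx Mherm).
apply/(eigenvalue_diagonalized _ (spectral_unit Mc) Mspec).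
by exists 0.
Qed.

(** The reflection in the hyperplane orthogonal to u - e_0 exchanges the unit
    vectors e_0 and u.  It supplies an orthogonal change of basis starting
    with a prescribed unit vector. *)
Lemma householder (R : realFieldType) (n : nat) (u : 'cV[R]_n.+1) :
  bform 1%:M u u = 1 ->
  exists Q : 'M[R]_n.+1, [/\ Q^T = Q, Q *m Q = 1%:M & Q *m delta_mx 0 0 = u].
Proof.
move=> uu; pose e : 'cV[R]_n.+1 := delta_mx 0 0; pose w := u - e.
pose s := bform 1%:M w w.
have ee : bform 1%:M e e = 1.
  by rewrite /bform mulmx1 trmx_delta mul_delta_mx mxE !eqxx.
have eu : bform 1%:M e u = bform 1%:M u e by rewrite bform_sym // trmx1.
have we : 2 * bform 1%:M w e = - s.
  by rewrite /s /w !bformBl !bformBr uu ee eu; ring.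
have wM (x : 'cV[R]_n.+1) : w^T *m x = (bform 1%:M w x)%:M.
  by rewrite /bform mulmx1 -mx11_scalar.
have [w0|w0] := eqVneq w 0.
  exists 1%:M; rewrite trmx1 !mul1mx; split=> //.
  by apply/esym/eqP; rewrite -subr_eq0 -/e -/w w0.
have s0 : s != 0 by rewrite sqnorm_eq0.
pose W := w *m w^T.
have WW : W *m W = s *: W.
  by rewrite /W mulmxA -(mulmxA w) wM mul_mx_scalar -scalemxAl.
exists (1%:M - (2 / s) *: W); split.
- by rewrite raddfB /= linearZ /= trmx_mul trmxK trmx1.
- rewrite mulmxBl mul1mx mulmxBr mulmx1 -scalemxAl -scalemxAr WW.
  by apply/matrixP => i j; move: (W) => X; rewrite !mxE; field.
- rewrite mulmxBl mul1mx -scalemxAl -mulmxA wM mul_mx_scalar scalerA.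
  suff -> : 2 / s * bform 1%:M w (delta_mx 0 0) = -1.
    by rewrite scaleN1r opprK /w addrC subrK.
  by rewrite mulrAC we mulNr divff.
Qed.

(** Induction on the size: the reflection taking e_0 to a unit eigenvector
    makes the first column a multiple of e_0, hence by symmetry the first row
    as well, and the remaining diagonal block is symmetric. *)
Theorem symmetric_diagonalizable (R : rcfType) (n : nat) (M : 'M[R]_n) :
  M^T = M -> exists (P : 'M[R]_n) (d : 'rV[R]_n),
    P *m P^T = 1%:M /\ M = P^T *m diag_mx d *m P.
Proof.
elim: n M => [|n IHn] M Ms.
  by exists 1%:M, 0; split; rewrite [LHS]flatmx0 [RHS]flatmx0.
have [a /eigenvalueP[v vM v0]] := symmetric_eigenvalue_exists Ms.
have vv : 0 < bform 1%:M v^T v^T by rewrite sqnorm_gt0 trmx_eq0.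
pose c := (Num.sqrt (bform 1%:M v^T v^T))^-1; pose u := c *: v^T.
have uu : bform 1%:M u u = 1.
  rewrite bformZl bformZr mulrA -expr2 exprVn sqr_sqrtr ?ltW //.
  by rewrite mulVf // gt_eqF.
have Mu : M *m u = a *: u.
  by rewrite -scalemxAr -{1}Ms -trmx_mul vM linearZ /= !scalerA mulrC.
have [Q [Qs QQ Qe]] := householder uu.
pose e : 'cV[R]_(1 + n) := delta_mx 0 0.
pose B : 'M[R]_(1 + n) := Q *m M *m Q.
have Bs : B^T = B by rewrite !trmx_mul Qs Ms mulmxA.
have Be : B *m e = a *: e.
  by rewrite -mulmxA Qe -mulmxA Mu -scalemxAr -Qe mulmxA QQ mul1mx.
have ME : M = Q *m B *m Q by rewrite !mulmxA QQ mul1mx -mulmxA QQ mulmx1.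
clearbody B.
have Bcol i : B i 0 = a * (i == 0)%:R.
  by move/matrixP/(_ i 0): Be; rewrite -colE !mxE eqxx andbT.
have l0 (i : 'I_1) : lshift n i = 0 :> 'I_n.+1 by apply: val_inj; rewrite ord1.
have Bblock : B = block_mx a%:M 0 0 (drsubmx B).
  rewrite -[LHS]submxK; congr block_mx; apply/matrixP => i j.
  - by rewrite !mxE !ord1 l0 Bcol eqxx mulr1.
  - by rewrite -[in LHS]Bs !mxE l0 Bcol mulr0.
  - by rewrite !mxE l0 Bcol mulr0.
have Ns : (drsubmx B)^T = drsubmx B by rewrite trmx_drsub Bs.
have [P [d [PP Nd]]] := IHn _ Ns.
pose P1 : 'M[R]_(1 + n) := block_mx 1%:M 0 0 P.
pose D : 'rV[R]_(1 + n) := row_mx a%:M d.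
have P1T : P1^T = block_mx 1%:M 0 0 P^T by rewrite tr_block_mx trmx1 !trmx0.
have PP1 : P1 *m P1^T = 1%:M.
  rewrite P1T mulmx_block !mul0mx !mulmx0 !mulmx1 !addr0 add0r PP.
  by rewrite -scalar_mx_block.
have BE : B = P1^T *m diag_mx D *m P1.
  rewrite Bblock diag_mx_row P1T !mulmx_block Nd.
  rewrite !mul0mx !mulmx0 !mulmx1 !mul1mx !addr0 !add0r ?mul0mx ?mulmx0 ?addr0.
  by congr block_mx; apply/matrixP => i j; rewrite !mxE !ord1 mulr1n.
exists (P1 *m Q), D; rewrite trmx_mul Qs; split.
  by rewrite mulmxA -(mulmxA P1) QQ mulmx1.
by rewrite ME BE !mulmxA.
Qed.

(** * Positive definiteness, extreme eigenvalues, square roots *)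

(** The suprema that define extreme eigenvalues and condition numbers range
    over finitely many values; this form matches how those sets are written. *)
Lemma finite_has_ubound (R : realDomainType) (T : finType) (Q : T -> Prop) (f : T -> R) :
  has_ubound [set a : R | exists2 t, Q t & a = f t]%classic.
Proof.
exists (\sum_t `|f t|) => _ [t _ ->].
rewrite (le_trans (ler_norm _)) // (bigD1 t) //= lerDl.
by apply: sumr_ge0 => *; rewrite normr_ge0.
Qed.

Lemma posdef_unitmx (R : realType) (n : nat) (M : 'M[R]_n) :
  posdefmx M -> M \in unitmx.
Proof.
case=> Ms Mpos; rewrite -row_free_unit -kermx_eq0.
apply/eqP/row_matrixP => i; rewrite row0; apply/eqP/negPn/negP => v0.
have := Mpos (row i (kermx M))^T; rewrite trmx_eq0 => /(_ v0).
rewrite trmxK; have /sub_kermxP -> := row_sub i (kermx M).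
by rewrite mul0mx mxE ltxx.
Qed.

(** The left inverse V certifies that U is injective. *)
Lemma posdef_congr (R : realType) (m n : nat) (M : 'M[R]_n) (U : 'M[R]_(n, m))
    (V : 'M[R]_(m, n)) :
  posdefmx M -> V *m U = 1%:M -> posdefmx (U^T *m M *m U).
Proof.
case=> Ms Mpos VU; split=> [|x x0]; first by rewrite !trmx_mul trmxK Ms mulmxA.
rewrite -/(bform _ _ _) -bform_mull; apply: Mpos.
by apply: contraNneq x0 => Ux0; rewrite -[x]mul1mx -VU -mulmxA Ux0 mulmx0.
Qed.

Lemma posdef1 (R : realType) (n : nat) : posdefmx (1%:M : 'M[R]_n).
Proof. by split=> [|x x0]; [rewrite trmx1 | rewrite -/(bform _ _ _) sqnorm_gt0]. Qed.

Lemma posdef_semidef (R : realType) (n : nat) (M : 'M[R]_n) :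
  posdefmx M -> possemidefmx M.
Proof.
case=> Ms Mpos; split=> // x; have [->|x0] := eqVneq x 0; last exact/ltW/Mpos.
by rewrite mulmx0 mxE.
Qed.

Lemma eigenvalue_symmetric (R : realType) (n : nat) (P : 'M[R]_n) (d : 'rV[R]_n)
    (a : R) :
  P *m P^T = 1%:M ->
  eigenvalue (P^T *m diag_mx d *m P) a <-> exists i, a = d 0 i.
Proof.
move=> PP; have [Pu _] := mulmx1_unit PP.
have -> : P^T = invmx P by rewrite -[LHS]mul1mx -(mulVmx Pu) -mulmxA PP mulmx1.
exact: (eigenvalue_diagonalized _ Pu).
Qed.

Lemma bform_spectral (R : realType) (n : nat) (P : 'M[R]_n) (d : 'rV[R]_n)
    (x : 'cV[R]_n) :
  bform (P^T *m diag_mx d *m P) x x = \sum_i d 0 i * (P *m x) i 0 ^+ 2.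
Proof. by rewrite -bform_mull bform_diag. Qed.

(** The trace is the sum of the n diagonal values in an eigenbasis, each of
    which is at most the largest eigenvalue. *)
Lemma trace_le_lambda_max (R : realType) (n : nat) (M : 'M[R]_n) :
  M^T = M -> \tr M <= n%:R * lambda_max M.
Proof.
move=> /symmetric_diagonalizable[P [d [PP ->]]].
rewrite mxtrace_mulC mulmxA PP mul1mx mxtrace_diag.
rewrite -[n in n%:R]card_ord mulr_natl -sumr_const ler_sum // => i _.
apply: ub_le_sup; last by apply/eigenvalue_symmetric => //; exists i.
have [b bub] := @finite_has_ubound R _ (fun=> True) (d 0).
exists b => a /(eigenvalue_symmetric _ _ PP)[j ->].
by apply: bub; exists j.
Qed.

Lemma lambda_max_le (R : realType) (n : nat) (M : 'M[R]_n) (c : R) :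
  (0 < n)%N -> M^T = M -> (forall a, eigenvalue M a -> a <= c) -> lambda_max M <= c.
Proof.
case: n M => // n M _ /symmetric_eigenvalue_exists Mev Mle.
exact: ge_sup.
Qed.

Lemma lambda_min_form (R : realType) (n : nat) (M : 'M[R]_n) (x : 'cV[R]_n) :
  M^T = M -> lambda_min M * bform 1%:M x x <= bform M x x.
Proof.
move=> /symmetric_diagonalizable[P [d [PP ->]]].
rewrite bform_spectral.
have -> : bform 1%:M x x = bform 1%:M (P *m x) (P *m x).
  by rewrite bform_mull mulmx1 (mulmx1C PP).
rewrite sqnormE mulr_sumr ler_sum // => i _.
rewrite ler_wpM2r ?sqr_ge0 //.
apply: ge_inf; last by apply/eigenvalue_symmetric => //; exists i.
have [b bub] := @finite_has_ubound R _ (fun=> True) (fun i => - d 0 i).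
exists (- b) => a /(eigenvalue_symmetric _ _ PP)[j ->].
by rewrite lerNl; apply: bub; exists j.
Qed.

(** The smallest eigenvalue is attained by a diagonal entry in an eigenbasis,
    and each of these is the value of the form at a unit eigenvector. *)
Lemma lambda_min_gt0 (R : realType) (n : nat) (M : 'M[R]_n) :
  (0 < n)%N -> posdefmx M -> 0 < lambda_min M.
Proof.
case: n M => // n M _ [Ms Mpos].
have [P [d [PP MD]]] := symmetric_diagonalizable Ms.
have dpos i : 0 < d 0 i.
  have := Mpos (P^T *m delta_mx i 0).
  rewrite -/(bform _ _ _) MD bform_spectral mulmxA PP mul1mx.
  rewrite (bigD1 i) //= big1 => [|j ji]; last first.
    by rewrite mxE (negPf ji) expr0n mulr0.
  rewrite mxE !eqxx expr1n mulr1 addr0; apply.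
  apply: contraTneq (oner_neq0 R) => /(congr1 (mulmx P)).
  rewrite mulmxA PP mul1mx mulmx0 => /matrixP/(_ i 0)/eqP.
  by rewrite !mxE !eqxx /= => ->.
(* An index with the least diagonal value bounds the infimum from below. *)
have [i _ imin] := @Order.TotalTheory.arg_minP _ R 'I_n.+1 0 xpredT (d 0) isT.
apply: (lt_le_trans (dpos i)); apply: lb_le_inf.
  exact: symmetric_eigenvalue_exists.
move=> a; rewrite /= MD => /(eigenvalue_symmetric _ _ PP)[j ->].
exact: imin.
Qed.

(** The chosen root exists: take square roots of the eigenvalues in an
    orthonormal eigenbasis. *)
Lemma sqrtmx_spec (R : realType) (n : nat) (M : 'M[R]_n) :
  possemidefmx M -> possemidefmx (sqrtmx M) /\ sqrtmx M *m sqrtmx M = M.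
Proof.
move=> [Ms Mpos].
apply: (@xgetPex _ 0 [set X : 'M[R]_n | possemidefmx X /\ X *m X = M]%classic).
have [P [d [PP MD]]] := symmetric_diagonalizable Ms.
have dpos i : 0 <= d 0 i.
  have := Mpos (P^T *m delta_mx i 0).
  rewrite -/(bform _ _ _) MD bform_spectral mulmxA PP mul1mx.
  rewrite (bigD1 i) //= big1 => [|j ji]; last first.
    by rewrite mxE (negPf ji) expr0n mulr0.
  by rewrite mxE !eqxx expr1n mulr1 addr0.
pose X := P^T *m diag_mx (\row_i Num.sqrt (d 0 i)) *m P.
exists X; split; first split.
- by rewrite /X !trmx_mul trmxK tr_diag_mx mulmxA.
- move=> x; rewrite -/(bform _ _ _) bform_spectral sumr_ge0 // => i _.
  by rewrite mxE mulr_ge0 ?sqrtr_ge0 ?sqr_ge0.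
rewrite /X MD -!mulmxA; congr (_ *m _); rewrite !mulmxA; congr (_ *m _).
rewrite -(mulmxA _ P) PP mulmx1; apply/matrixP => i j.
rewrite mul_diag_mx !mxE; case: eqP => [->|_]; last by rewrite !mulr0n mulr0.
by rewrite !mulr1n -expr2 sqr_sqrtr.
Qed.

Lemma moore_penrose_unit (R : realType) (n : nat) (M : 'M[R]_n) :
  M \in unitmx -> moore_penrose M = invmx M.
Proof.
move=> Mu.
have [MXM _ _ _] : is_moore_penrose M (moore_penrose M).
  apply: (@xgetPex _ 0 (is_moore_penrose M)); exists (invmx M).
  by split; rewrite ?mulmxV ?mulVmx ?mul1mx ?trmx1.
apply: (can_inj (mulmxK Mu)); apply: (can_inj (mulKmx Mu)).
by rewrite mulVmx // mulmx1 mulmxA.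
Qed.

(** * Averages over the subsets of size p *)

(** Scalar counterpart of [subset_mean], so that quadratic forms, traces and
    entries of a mean of matrices become means of numbers. *)
Definition mean (R : realType) (n p : nat) (f : {set 'I_n} -> R) : R :=
  #|[pred J : {set 'I_n} | #|J| == p]|%:R^-1 * \sum_(J : {set 'I_n} | #|J| == p) f J.

Lemma subset_meanE (R : realType) (n p : nat) (F : {set 'I_n} -> 'M[R]_n) i j :
  subset_mean p F i j = mean p (fun J => F J i j).
Proof. by rewrite mxE summxE. Qed.

Lemma subset_mean_mul (R : realType) (n p : nat) (L M : 'M[R]_n)
    (F : {set 'I_n} -> 'M[R]_n) :
  L *m subset_mean p F *m M = subset_mean p (fun J => L *m F J *m M).
Proof.
rewrite /subset_mean -scalemxAr -scalemxAl mulmx_sumr mulmx_suml.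
by [].
Qed.

Lemma subset_mean_bform (R : realType) (n p : nat) (F : {set 'I_n} -> 'M[R]_n)
    (x y : 'cV[R]_n) :
  bform (subset_mean p F) x y = mean p (fun J => bform (F J) x y).
Proof.
rewrite /bform /subset_mean -scalemxAr -scalemxAl mulmx_sumr mulmx_suml.
by rewrite mxE summxE.
Qed.

Lemma subset_mean_trace (R : realType) (n p : nat) (F : {set 'I_n} -> 'M[R]_n) :
  \tr (subset_mean p F) = mean p (fun J => \tr (F J)).
Proof. by rewrite /subset_mean linearZ /= raddf_sum. Qed.

Lemma subset_mean_sym (R : realType) (n p : nat) (F : {set 'I_n} -> 'M[R]_n) :
  (forall J : {set 'I_n}, #|J| = p -> (F J)^T = F J) ->
  (subset_mean p F)^T = subset_mean p F.
Proof.
move=> Fs; rewrite /subset_mean linearZ /= raddf_sum /=; congr (_ *: _).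
by apply: eq_bigr => J /eqP /Fs.
Qed.

Lemma le_mean (R : realType) (n p : nat) (f g : {set 'I_n} -> R) :
  (forall J : {set 'I_n}, #|J| = p -> f J <= g J) -> mean p f <= mean p g.
Proof.
move=> fg; rewrite ler_wpM2l ?invr_ge0 ?ler0n //.
by apply: ler_sum => J /eqP /fg.
Qed.

Lemma meanB (R : realType) (n p : nat) (f g : {set 'I_n} -> R) :
  mean p (fun J => f J - g J) = mean p f - mean p g.
Proof. by rewrite /mean sumrB mulrBr. Qed.

Lemma meanZ (R : realType) (n p : nat) (c : R) (f : {set 'I_n} -> R) :
  mean p (fun J => c * f J) = c * mean p f.
Proof. by rewrite /mean -mulr_sumr mulrCA. Qed.

(** Complementation turns the p-subsets containing D into the subsets of
    the complement of D with n - p elements, which are counted directly. *)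
Lemma card_supersets (n p : nat) (D : {set 'I_n}) : (p <= n)%N ->
  #|[pred J : {set 'I_n} | (#|J| == p) && (D \subset J)]| = 'C(n - #|D|, n - p).
Proof.
move=> pn; have <- : #|~: D| = (n - #|D|)%N by rewrite cardsCs finset.setCK card_ord.
rewrite -cards_draws -(card_imset _ (can_inj (@finset.setCK _))).
apply: eq_card => J; rewrite [LHS]inE; apply/idP/imsetP => [/andP[/eqP Jp DJ]|[K]].
  exists (~: J); last by rewrite finset.setCK.
  by rewrite inE finset.setCS DJ cardsCs finset.setCK card_ord Jp /=.
rewrite inE => /andP[KD /eqP Kc] ->.
by rewrite -finset.setCS finset.setCK KD cardsCs finset.setCK card_ord Kc subKn ?eqxx.
Qed.

Lemma mean_superset (R : realType) (n p : nat) (D : {set 'I_n}) : (p <= n)%N ->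
  mean p (fun J => (D \subset J)%:R) = 'C(n - #|D|, n - p)%:R / 'C(n, n - p)%:R :> R.
Proof.
move=> pn; rewrite /mean mulrC; congr (_ / _%:R).
  by under eq_bigr do rewrite mulrb; rewrite -big_mkcondr /= sumr_const card_supersets.
have := card_supersets finset.set0 pn; rewrite cards0 subn0 => <-.
by apply: eq_card => J; rewrite !inE finset.sub0set andbT.
Qed.

Lemma mean_const (R : realType) (n p : nat) (c : R) : (p <= n)%N ->
  @mean R n p (fun=> c) = c.
Proof.
move=> pn; have := @mean_superset R n p finset.set0 pn.
rewrite cards0 subn0 divff ?pnatr_eq0 -?lt0n ?bin_gt0 ?leq_subr // => H1.
rewrite -[RHS]mulr1 -H1 -meanZ; congr (_ * _); apply: eq_bigr => J _.
by rewrite finset.sub0set mulr1.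
Qed.

Lemma mean_mem (R : realType) (n p : nat) (i : 'I_n) : (p <= n)%N ->
  mean p (fun J => (i \in J)%:R) = p%:R / n%:R :> R.
Proof.
move=> pn; have n0 : n%:R != 0 :> R by rewrite pnatr_eq0; case: (n) i => // -[].
have -> : mean p (fun J => (i \in J)%:R)
    = mean p (fun J => ([set i] \subset J)%:R) :> R.
  by congr (_ * _); apply: eq_bigr => J _; rewrite finset.sub1set.
rewrite mean_superset // cards1 subn1; apply/eqP.
rewrite eqr_div // ?pnatr_eq0 -?lt0n ?bin_gt0 ?leq_subr //.
by rewrite -!natrM mulnC mul_bin_down subKn.
Qed.

Lemma mean_mem2 (R : realType) (n p : nat) (i j : 'I_n) : (1 < p <= n)%N -> i != j ->
  mean p (fun J => ((i \in J) && (j \in J))%:R)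
    = p%:R / n%:R * ((p%:R - 1) / (n%:R - 1)) :> R.
Proof.
move=> /andP[p1 pn] ij.
have -> : mean p (fun J => ((i \in J) && (j \in J))%:R)
    = mean p (fun J => ([set i; j] \subset J)%:R) :> R.
  by congr (_ * _); apply: eq_bigr => J _; rewrite finset.subUset !finset.sub1set.
have n1 := leq_trans p1 pn.
rewrite mean_superset // cards2 ij /=.
have -> : n%:R - 1 = n.-1%:R :> R by rewrite -subn1 natrB // ltnW.
have -> : p%:R - 1 = p.-1%:R :> R by rewrite -subn1 natrB // ltnW.
rewrite mulf_div; apply/eqP; rewrite eqr_div.
- have e1 := mul_bin_down n (n - p); have e2 := mul_bin_down n.-1 (n - p).
  rewrite subKn // in e1; have pE : (n.-1 - (n - p) = p.-1)%N by lia.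
  rewrite pE in e2; rewrite -!natrM subn2; apply/eqP; congr (_%:R).
  transitivity (n * (n.-1 * 'C(n.-2, n - p)))%N; first by ring.
  rewrite e2; transitivity (p.-1 * (n * 'C(n.-1, n - p)))%N; first by ring.
  by rewrite e1; ring.
- by rewrite pnatr_eq0 -lt0n bin_gt0 leq_subr.
- by rewrite mulf_neq0 // pnatr_eq0; lia.
Qed.

(** The orthogonal projection onto the coordinates in J; it lets the
    argument stay with n x n matrices whatever the size of J. *)
Definition selproj (R : realType) (n : nat) (J : {set 'I_n}) : 'M[R]_n :=
  selector_mx R J *m (selector_mx R J)^T.

Lemma selector_tr_mul (R : realType) (n : nat) (J : {set 'I_n}) :
  (selector_mx R J)^T *m selector_mx R J = 1%:M.
Proof.
apply/matrixP => k l; rewrite !mxE (bigD1 (enum_val k)) //= big1 => [|i ik].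
  by rewrite !mxE eqxx mul1r addr0 (inj_eq enum_val_inj).
by rewrite !mxE (negPf ik) mul0r.
Qed.

Lemma selprojE (R : realType) (n : nat) (J : {set 'I_n}) :
  selproj R J = diag_mx (\row_i (i \in J)%:R).
Proof.
apply/matrixP => i j; rewrite !mxE.
have [iJ|iJ] := boolP (i \in J).
  rewrite (bigD1 (enum_rank_in iJ i)) //= big1 => [|k].
    by rewrite !mxE enum_rankK_in // eqxx mul1r addr0 eq_sym.
  rewrite !mxE => ki; case: eqP => [ik|_]; last by rewrite mul0r.
  by case/eqP: ki; apply: enum_val_inj; rewrite enum_rankK_in.
rewrite mul0rn big1 // => k _; rewrite !mxE; case: eqP => [ik|_]; last by rewrite mul0r.
by case/negP: iJ; rewrite ik enum_valP.
Qed.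

Lemma principal_submxE (R : realType) (n : nat) (J : {set 'I_n}) (A : 'M[R]_n) :
  (selector_mx R J)^T *m A *m selector_mx R J = principal_submx J A.
Proof.
apply/matrixP => k l; rewrite !mxE (bigD1 (enum_val l)) //= big1 => [|i il].
  rewrite !mxE eqxx mulr1 addr0 (bigD1 (enum_val k)) //= big1 => [|i ik].
    by rewrite !mxE eqxx mul1r addr0.
  by rewrite !mxE (negPf ik) mul0r.
by rewrite [X in _ * X]mxE (negPf il) mulr0.
Qed.

Lemma selproj_conjE (R : realType) (n : nat) (J : {set 'I_n}) (A : 'M[R]_n) i j :
  (selproj R J *m A *m selproj R J) i j = A i j * ((i \in J) && (j \in J))%:R.
Proof.
rewrite selprojE mul_mx_diag mxE mul_diag_mx !mxE -mulnb natrM.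
by ring.
Qed.

Lemma mean_selproj (R : realType) (n p : nat) : (p <= n)%N ->
  subset_mean p (@selproj R n) = (p%:R / n%:R)%:M.
Proof.
move=> pn; apply/matrixP => i j; rewrite subset_meanE mxE.
rewrite -(@mean_mem R n p i) // -mulr_natr mulrC -meanZ.
congr (_ * _); apply: eq_bigr => J _.
by rewrite selprojE !mxE mulr_natl.
Qed.

(** Averaging the blocks of A keeps a diagonal entry with probability p/n
    and an off-diagonal one with probability p(p-1)/(n(n-1)), so the mean is
    p/n times an interpolation between A and its diagonal. *)
Lemma mean_selproj_conj (R : realType) (n p : nat) (A : 'M[R]_n) : (1 < p <= n)%N ->
  let r := (p%:R - 1) / (n%:R - 1) in
  subset_mean p (fun J => selproj R J *m A *m selproj R J)
    = (p%:R / n%:R) *: (r *: A + (1 - r) *: diag_mx (\row_i A i i)).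
Proof.
move=> /[dup] /andP[_ pn] p1n r; apply/matrixP => i j; rewrite subset_meanE !mxE.
have -> : mean p (fun J => (selproj R J *m A *m selproj R J) i j)
    = A i j * mean p (fun J => ((i \in J) && (j \in J))%:R).
  by rewrite -meanZ; congr (_ * _); apply: eq_bigr => J _; rewrite selproj_conjE.
have [<-|ij] := eqVneq i j.
  have -> : mean p (fun J => ((i \in J) && (i \in J))%:R)
      = mean p (fun J => (i \in J)%:R) :> R.
    by congr (_ * _); apply: eq_bigr => J _; rewrite andbb.
  by rewrite mean_mem // mulr1n; ring.
by rewrite mean_mem2 // mulr0n -/r; ring.
Qed.

(** * The inverse of a principal block and its mean *)

(** The inverse of the principal block of A indexed by J, padded with zeros:
    the matrix called H in the theorem. *)
Definition subinv (R : realType) (n : nat) (A : 'M[R]_n) (J : {set 'I_n}) : 'M[R]_n :=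
  let S := selector_mx R J in S *m moore_penrose (S^T *m A *m S) *m S^T.

Lemma subinvE (R : realType) (n : nat) (A : 'M[R]_n) (J : {set 'I_n}) :
  posdefmx A ->
  let S := selector_mx R J in subinv A J = S *m invmx (S^T *m A *m S) *m S^T.
Proof.
move=> Apd S; rewrite /subinv moore_penrose_unit //.
exact/posdef_unitmx/(posdef_congr Apd (selector_tr_mul R J)).
Qed.

Lemma subinv_sym (R : realType) (n : nat) (A : 'M[R]_n) (J : {set 'I_n}) :
  posdefmx A -> (subinv A J)^T = subinv A J.
Proof.
move=> Apd; rewrite subinvE // !trmx_mul trmx_inv !trmx_mul !trmxK.
by case: Apd => -> _; rewrite !mulmxA.
Qed.

(** The padded inverse only reads the J-coordinates of its argument, and there
    A acts on vectors supported on J as the block that was inverted. *)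
Lemma subinv_mul_selproj (R : realType) (n : nat) (A : 'M[R]_n) (J : {set 'I_n}) :
  posdefmx A -> subinv A J *m A *m selproj R J = selproj R J.
Proof.
move=> Apd; rewrite subinvE // /selproj.
set S := selector_mx R J; set B := S^T *m A *m S.
transitivity (S *m (invmx B *m B) *m S^T); first by rewrite /B !mulmxA.
rewrite mulVmx ?mulmx1 //.
exact/posdef_unitmx/(posdef_congr Apd (selector_tr_mul R J)).
Qed.

Lemma selproj_mul_subinv (R : realType) (n : nat) (A : 'M[R]_n) (J : {set 'I_n}) :
  selproj R J *m subinv A J = subinv A J.
Proof.
by rewrite /selproj /subinv !mulmxA -(mulmxA _ _^T) selector_tr_mul mulmx1.
Qed.

Lemma subinv_idem (R : realType) (n : nat) (A : 'M[R]_n) (J : {set 'I_n}) :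
  posdefmx A -> subinv A J *m A *m subinv A J = subinv A J.
Proof.
move=> Apd; rewrite -{2}(selproj_mul_subinv A J) mulmxA subinv_mul_selproj //.
exact: selproj_mul_subinv.
Qed.

Lemma selproj_sym (R : realType) (n : nat) (J : {set 'I_n}) :
  (selproj R J)^T = selproj R J.
Proof. by rewrite trmx_mul trmxK. Qed.

(** The variational bound y^T B^-1 y >= 2 y^T w - w^T B w for the block B of
    A at J: the difference of the two sides is the A-form at H x - D w, with
    H the padded inverse and D the projection onto J. *)
Lemma subinv_form_ge (R : realType) (n : nat) (A : 'M[R]_n) (J : {set 'I_n})
    (x w : 'cV[R]_n) :
  posdefmx A ->
  2 * bform (selproj R J) x w - bform (selproj R J *m A *m selproj R J) w w
    <= bform (subinv A J) x x.
Proof.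
move=> Apd; have [As Apos] := posdef_semidef Apd.
set H := subinv A J; set D := selproj R J.
have := Apos (H *m x - D *m w); rewrite -/(bform _ _ _) bformBl !bformBr.
rewrite [bform A (D *m w) (H *m x)]bform_sym // !bform_mull.
have -> : bform A (H *m x) (D *m w) = bform D x w.
  rewrite /bform trmx_mul subinv_sym //; congr (_ 0 0).
  transitivity (x^T *m (H *m A *m D) *m w); first by rewrite !mulmxA.
  by rewrite subinv_mul_selproj.
rewrite subinv_sym // subinv_idem // selproj_sym.
by move=> ?; lra.
Qed.

Section SubsetMean.

Variables (R : realType) (n p : nat) (A : 'M[R]_n).
Hypotheses (Apd : posdefmx A) (p1 : (1 < p)%N) (pn : (p <= n)%N).

Let c : R := p%:R / n%:R.
Let N := subset_mean p (fun J => selproj R J *m A *m selproj R J).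
Let G := subset_mean p (subinv A).

Let c_gt0 : 0 < c.
Proof. by rewrite divr_gt0 // ltr0n; lia. Qed.

(** The variational bound is affine in the random matrices, so unlike the
    inverse itself it can be averaged term by term. *)
Lemma mean_subinv_form_ge (x w : 'cV[R]_n) :
  2 * (c * bform 1%:M x w) - bform N w w <= bform G x x.
Proof.
have -> : c * bform 1%:M x w = bform (subset_mean p (@selproj R n)) x w.
  by rewrite mean_selproj // /bform mulmx1 mul_mx_scalar -scalemxAl [RHS]mxE.
rewrite !subset_mean_bform -meanZ -meanB; apply: le_mean => J _.
exact: subinv_form_ge.
Qed.

Lemma mean_conj_form_ge0 (x : 'cV[R]_n) : 0 <= bform N x x.
Proof.
rewrite subset_mean_bform -(@mean_const R n p 0 pn); apply: le_mean => J _.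
rewrite -{1}(selproj_sym R J) -bform_mull.
by case: (posdef_semidef Apd) => _; apply.
Qed.

(** Apply the averaged bound to w = t x: the linear term wins over the
    quadratic one for small t > 0. *)
Lemma mean_subinv_posdef : posdefmx G.
Proof.
split=> [|x x0]; first by apply: subset_mean_sym => J _; exact: subinv_sym.
pose m := c * bform 1%:M x x; pose q := bform N x x.
have m0 : 0 < m by rewrite mulr_gt0 // sqnorm_gt0.
have q0 : 0 <= q := mean_conj_form_ge0 x.
(* The maximizer m / q of 2 t m - t^2 q, shifted so that q = 0 is allowed. *)
pose t := m / (q + 1).
have t0 : 0 < t by rewrite divr_gt0 // ltr_wpDl.
have tq : t * q <= m.
  rewrite /t mulrAC ler_pdivrMr ?ltr_wpDl //.
  by rewrite (ler_wpM2l (ltW m0)) // lerDl.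
apply: lt_le_trans (mean_subinv_form_ge x (t *: x)).
rewrite !bformZl !bformZr -/q (_ : 2 * _ - _ = t * (2 * m - t * q)).
  by rewrite mulr_gt0 //; lra.
by rewrite /m; ring.
Qed.

(** Operator convexity of the inverse, in the special case that is used:
    the inverse of the mean G of the padded inverses is at most (n/p)^2 times
    the mean N of the blocks.  It is the averaged bound at x = G^-1 v and
    w = (n/p) v. *)
Lemma invmx_mean_subinv_form_le (v : 'cV[R]_n) :
  bform (invmx G) v v <= c^-1 ^+ 2 * bform N v v.
Proof.
have Gu := posdef_unitmx mean_subinv_posdef.
have [Gs _] := mean_subinv_posdef.
have := mean_subinv_form_ge (invmx G *m v) (c^-1 *: v).
rewrite !bformZl !bformZr bform_mull trmx_inv Gs mulVmx // mul1mx.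
have -> : bform 1%:M (invmx G *m v) v = bform (invmx G) v v.
  by rewrite /bform trmx_mul trmx_inv Gs mulmx1.
rewrite [c * _]mulrA mulfV ?gt_eqF // mul1r => h.
rewrite expr2 -mulrA; lra.
Qed.

End SubsetMean.

(** This is where the effective condition number enters.  For z supported on
    J, both sides compare through |z|^2: the diagonal form is at most
    max A_ii |z|^2, and the A-form, which only sees the block at J, is at
    least lambda_min |z|^2. *)
Lemma diag_form_le_kappa (R : realType) (n : nat) (A : 'M[R]_n) (J : {set 'I_n})
    (z : 'cV[R]_n) :
  posdefmx A -> (0 < #|J|)%N -> selproj R J *m z = z ->
  bform (diag_mx (\row_i A i i)) z z <= kappa_eff J A * bform A z z.
Proof.
move=> Apd J0 Dz; rewrite bform_diag /kappa_eff.
set m := sup _; set l := lambda_min _.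
have Am i : i \in J -> A i i <= m.
  move=> iJ; apply: ub_le_sup; last by exists i.
  exact: (@finite_has_ubound _ _ (fun i => i \in J) (fun i => A i i)).
have m0 : 0 <= m.
  have /card_gt0P[i iJ] := J0; apply: le_trans (Am i iJ).
  case: (posdef_semidef Apd) => _ /(_ (delta_mx i 0)).
  by rewrite trmx_delta -rowE -colE !mxE.
pose S := selector_mx R J; pose y := S^T *m z.
have zE : S *m y = z by rewrite mulmxA.
have Ajpd : posdefmx (principal_submx J A).
  by rewrite -principal_submxE; exact: (posdef_congr Apd (selector_tr_mul R J)).
have l0 : 0 < l := lambda_min_gt0 J0 Ajpd.
have yl : l * bform 1%:M z z <= bform A z z.
  rewrite -zE (bform_mull S 1%:M) (bform_mull S A).
  rewrite mulmx1 selector_tr_mul principal_submxE.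
  by apply: lambda_min_form; case: Ajpd.
apply: (@le_trans _ _ (m * bform 1%:M z z)).
  rewrite sqnormE mulr_sumr ler_sum // => i _; rewrite mxE.
  have [iJ|iJ] := boolP (i \in J); first by rewrite ler_wpM2r ?sqr_ge0 ?Am.
  suff -> : z i 0 = 0 by rewrite expr0n !mulr0.
  by rewrite -Dz selprojE mul_diag_mx !mxE (negPf iJ) mul0r.
by rewrite -mulrA ler_wpM2l // ler_pdivlMl.
Qed.

Lemma kappa_eff_le_size (R : realType) (n : nat) (A : 'M[R]_n) (J : {set 'I_n}) :
  kappa_eff J A <= kappa_eff_size #|J| A.
Proof.
apply: ub_le_sup; last by exists J.
exact: (@finite_has_ubound _ _ (fun K : {set 'I_n} => #|K| = #|J|)
          (fun K => kappa_eff K A)).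
Qed.

Lemma trace_mul_sym_ge0 (R : realDomainType) (n : nat) (Z : 'M[R]_n) :
  Z^T = Z -> 0 <= \tr (Z *m Z).
Proof.
move=> Zs; rewrite -{1}Zs; apply: sumr_ge0 => i _.
by rewrite mxE sumr_ge0 // => j _; rewrite mxE -expr2 sqr_ge0.
Qed.

(** A symmetric X factoring through a space of dimension q has
    tr(X^2) >= (tr X)^2 / q.  The linearized version with a free constant c is
    stated because it can be averaged; it expands tr((X - c P)^2) >= 0, with P
    the orthogonal projection onto the range of U. *)
Lemma trace_sq_ge (R : realType) (n q : nat) (U : 'M[R]_(n, q)) (B : 'M[R]_q) (c : R) :
  B^T = B -> U^T *m U \in unitmx ->
  2 * c * \tr (U *m B *m U^T) - c ^+ 2 * q%:R
    <= \tr ((U *m B *m U^T) *m (U *m B *m U^T)).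
Proof.
move=> Bs Uu; set X := U *m B *m U^T.
pose P := U *m invmx (U^T *m U) *m U^T.
have Xs : X^T = X by rewrite !trmx_mul trmxK Bs mulmxA.
have Ps : P^T = P by rewrite !trmx_mul trmx_inv trmx_mul !trmxK mulmxA.
have PU : P *m U = U by rewrite -mulmxA mulmxKV.
have PX : P *m X = X by rewrite !mulmxA PU.
have PP : P *m P = P by rewrite {2}/P !mulmxA PU.
have trP : \tr P = q%:R by rewrite mxtrace_mulC mulmxA mulmxV // mxtrace1.
have Zs : (X - c *: P)^T = X - c *: P by rewrite raddfB /= linearZ /= Xs Ps.
have := trace_mul_sym_ge0 Zs.
rewrite mulmxBl !mulmxBr -!scalemxAl -!scalemxAr PP PX.
rewrite !raddfB /= !linearZ /= [\tr (X *m P)]mxtrace_mulC PX trP.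
by move=> ?; lra.
Qed.

(** * Assembling the bounds *)

Theorem lemma3p8 (R : realType) (n p : nat) (A : 'M[R]_n)
    (A_posdef : posdefmx A) (p_gt1 : (1 < p)%N) (p_ltn : (p < n)%N) :
  let H := fun J : {set 'I_n} =>
    let S := selector_mx R J in
    S *m moore_penrose (S^T *m A *m S) *m S^T in
  let G := subset_mean p H in
  let Gm12 := invmx (sqrtmx G) in
  let nu := lambda_max (subset_mean p (fun J => (Gm12 *m H J *m Gm12) ^+ 2)) in
  let r := (p%:R - 1) / (n%:R - 1) : R in
  n%:R / p%:R <= nu /\
  nu <= n%:R / p%:R * (r + (1 - r) * kappa_eff_size p A).
Proof.
move=> H G K nu r.
have Hs J : (H J)^T = H J by exact: subinv_sym.
have pn := ltnW p_ltn.
have n0 : 0 < n%:R :> R by rewrite ltr0n; lia.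
have p0 : 0 < p%:R :> R by rewrite ltr0n; lia.
have r1 : 0 <= 1 - r.
  have n1 : 0 < n%:R - 1 :> R by rewrite subr_gt0 ltr1n; lia.
  rewrite subr_ge0 ler_pdivrMr // mul1r lerD2r ler_nat //.
have Gpd : posdefmx G by exact: mean_subinv_posdef.
have [[Qs _] QQ] := sqrtmx_spec (posdef_semidef Gpd).
have Gu := posdef_unitmx Gpd.
have Qu : sqrtmx G \in unitmx by have := Gu; rewrite -{1}QQ unitmx_mul andbb.
have Ks : K^T = K by rewrite trmx_inv Qs.
have KQ : K *m sqrtmx G = 1%:M := mulVmx Qu.
have QK : sqrtmx G *m K = 1%:M := mulmxV Qu.
have KGK : K *m G *m K = 1%:M.
  by rewrite -[X in K *m X]QQ mulmxA KQ mul1mx.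
have KK : K *m K = invmx G.
  apply: (can_inj (mulmxK Gu)); rewrite mulVmx // -mulmxA -[X in _ *m (_ *m X)]QQ.
  by rewrite (mulmxA K (sqrtmx G)) KQ mul1mx.
pose X J := K *m H J *m K.
have Xs J : (X J)^T = X J by rewrite trmx_mul Ks trmx_mul Ks Hs mulmxA.
have meanX : subset_mean p X = 1%:M by rewrite -subset_mean_mul.
pose W := subset_mean p (fun J => X J ^+ 2).
have Ws : W^T = W by apply: subset_mean_sym => J _; rewrite expr2 trmx_mul Xs.
(* Lower bound: the largest eigenvalue is at least the average tr W / n. *)
split.
- have: \tr W <= n%:R * nu := trace_le_lambda_max Ws.
  rewrite mulrC -ler_pdivrMr //; apply: le_trans.
  rewrite ler_pdivlMr // subset_mean_trace.
  (* The average trace of X is n and its rank is p: this c is the value of the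
     nonzero eigenvalues in the case of equality. *)
  pose c : R := n%:R / p%:R.
  have -> : c * n%:R
      = mean p (fun J => 2 * c * \tr (X J) - @mean R n p (fun=> c ^+ 2 * p%:R)).
    rewrite meanB !mean_const // meanZ -subset_mean_trace meanX mxtrace1 /c.
    by field; rewrite gt_eqF.
  apply: le_mean => J Jp; rewrite mean_const // -Jp expr2.
  have XE : X J = (K *m selector_mx R J)
      *m invmx ((selector_mx R J)^T *m A *m selector_mx R J)
      *m (K *m selector_mx R J)^T.
    by rewrite /X /H -/(subinv A J) subinvE // trmx_mul Ks !mulmxA.
  rewrite XE; apply: trace_sq_ge.
    by rewrite trmx_inv !trmx_mul trmxK; case: A_posdef => -> _; rewrite mulmxA.
  rewrite -[X in X *m _]mulmx1; apply/posdef_unitmx.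
  apply: (posdef_congr (V := (selector_mx R J)^T *m sqrtmx G)); first exact: posdef1.
  by rewrite mulmxA -(mulmxA _ (sqrtmx G)) mulmxV // mulmx1 selector_tr_mul.
(* Upper bound: test an eigenvector u for a. *)
apply: lambda_max_le => //; first by lia.
move=> a /eigenvalueP[v vW v0]; pose u := v^T.
have uu : 0 < bform 1%:M u u by rewrite sqnorm_gt0 trmx_eq0.
rewrite -(ler_pM2r uu).
set C := _ * (_ + _).
have -> : a * bform 1%:M u u = bform W u u.
  by rewrite /bform mulmx1 trmxK vW -scalemxAl [RHS]mxE.
have -> : bform 1%:M u u = mean p (fun J => bform (X J) u u).
  by rewrite -subset_mean_bform meanX.
rewrite subset_mean_bform -meanZ; apply: le_mean => J Jp.
(* Since H = H A H, both u^T X^2 u and u^T X u are forms at this z, which is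
   supported on J: the comparison reduces to G^-1 against A there. *)
pose z := H J *m (K *m u).
have -> : bform (X J ^+ 2) u u = bform (invmx G) z z.
  rewrite /z mulmxA bform_mull trmx_mul Ks Hs -KK; congr bform.
  by rewrite expr2 -mulmxE /X !mulmxA.
have -> : bform (X J) u u = bform A z z.
  by rewrite /z !bform_mull Hs (subinv_idem J A_posdef) Ks.
have Dz : selproj R J *m z = z by rewrite mulmxA selproj_mul_subinv.
apply: le_trans (invmx_mean_subinv_form_le A_posdef p_gt1 pn z) _.
rewrite mean_selproj_conj ?p_gt1 // -/r.
have -> : bform ((p%:R / n%:R) *: (r *: A + (1 - r) *: diag_mx (\row_i A i i))) z z
   = p%:R / n%:R * (r * bform A z z + (1 - r) * bform (diag_mx (\row_i A i i)) z z).
  rewrite /bform -scalemxAr -scalemxAl mulmxDr mulmxDl -!scalemxAr -!scalemxAl.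
  by rewrite !mxE.
have Azz : 0 <= bform A z z by case: (posdef_semidef A_posdef) => _; apply.
have dz : bform (diag_mx (\row_i A i i)) z z <= kappa_eff_size p A * bform A z z.
  apply: le_trans (diag_form_le_kappa A_posdef _ Dz) _; first by lia.
  by rewrite ler_wpM2r // -Jp kappa_eff_le_size.
have -> : C * bform A z z = (n%:R / p%:R)
    * (r * bform A z z + (1 - r) * (kappa_eff_size p A * bform A z z)).
  by rewrite /C; ring.
rewrite mulrA (_ : _ ^+ 2 * _ = n%:R / p%:R); last by field; rewrite !gt_eqF.
by rewrite ler_wpM2l ?divr_ge0 // lerD2l ler_wpM2l.
Qed.
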